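(* Let $t \ge 1$ and let $n < m$ be natural numbers. If $\phi$ is a $\mathcal{C}_3^t$-sentence such that $\mathcal{A}_n \models \phi$ and $\mathcal{A}_m \models \neg\phi$, then $|\phi| \ge \frac{\sqrt{n}}{t}$.
   Context: Structures are finite linear orders over the signature $\{min, max, <, succ\}$ (with equality), where $<$ is the linear order, $succ$ the successor relation, and $min, max$ the least and greatest elements. $\mathcal{A}_n$ denotes the linear order on $\{0,1,\dots,n\}$ with the standard order. Counting logic $\mathcal{C}$ is first-order logic extended by counting quantifiers $\exists^{\ge k} x\, \varphi$ (there are at least $k$ distinct values of $x$ satisfying $\varphi$) and $\forall^{\ge k} x\,\varphi := \neg\exists^{\ge k} x\,\neg\varphi$, for $k \ge 1$; the counting rank of a formula is the maximum $k$ occurring in its quantifiers. $\mathcal{C}_3^t$ is the fragment of formulas using at most 3 variables ($x,y,z$) and counting rank at most $t$. Formula size: $|\text{atomic}| = 1$, $|\neg\varphi| = |\varphi|+1$, $|\varphi\vee\psi| = |\varphi\wedge\psi| = |\varphi|+|\psi|$, $|\exists^{\ge k}x\,\varphi| = |\forall^{\ge k}x\,\varphi| = |\varphi|+1$. *)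

(* Defs.v *)
(* Written against MathComp. *)
From HB Require Import structures.
From mathcomp Require Import all_boot all_order all_algebra.

Set Implicit Arguments.
Unset Strict Implicit.
Unset Printing Implicit Defensive.

(* Terms and formulas of the counting logic C over {min, max, <, succ} whose  *)
(* variables, free or bound, are taken from the s variables of 'I_s.          *)
Inductive term (s : nat) : Type :=
  | Var of 'I_s
  | Min
  | Max.

Arguments Min {s}.
Arguments Max {s}.

(* Every quantifier is a counting quantifier with threshold k >= 1; the usual *)
(* first-order quantifiers are the case k = 1. The universal one is primitive *)
(* because its size is not that of its definition by negations.               *)
Inductive formula (s : nat) : Type :=
  | Eq of term s & term s
  | Lt of term s & term s
  | Succ of term s & term s
  | Not of formula s
  | Or of formula s & formula s
  | And of formula s & formula s
  | ExistsGe (k : nat) of (0 < k)%N & 'I_s & formula s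
  | ForallGe (k : nat) of (0 < k)%N & 'I_s & formula s.

Fixpoint fsize (s : nat) (phi : formula s) : nat :=
  match phi with
  | Eq _ _ | Lt _ _ | Succ _ _ => 1
  | Not psi => fsize psi + 1
  | Or psi chi | And psi chi => fsize psi + fsize chi
  | ExistsGe _ _ _ psi | ForallGe _ _ _ psi => fsize psi + 1
  end.

Fixpoint counting_rank (s : nat) (phi : formula s) : nat :=
  match phi with
  | Eq _ _ | Lt _ _ | Succ _ _ => 0
  | Not psi => counting_rank psi
  | Or psi chi | And psi chi => maxn (counting_rank psi) (counting_rank chi)
  | ExistsGe k _ _ psi | ForallGe k _ _ psi => maxn k (counting_rank psi)
  end.

Definition term_vars (s : nat) (u : term s) : {set 'I_s} :=
  if u is Var v then [set v] else set0.

Fixpoint free_vars (s : nat) (phi : formula s) : {set 'I_s} :=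
  match phi with
  | Eq u w | Lt u w | Succ u w => term_vars u :|: term_vars w
  | Not psi => free_vars psi
  | Or psi chi | And psi chi => free_vars psi :|: free_vars chi
  | ExistsGe _ _ v psi | ForallGe _ _ v psi => free_vars psi :\ v
  end.

Definition sentence (s : nat) (phi : formula s) : Prop :=
  free_vars phi = set0.

Record structure : Type := Structure {
  dom :> finType;
  min_of : dom;
  max_of : dom;
  lt_of : rel dom;
  succ_of : rel dom }.

(* The linear order A_n on {0, ..., n}, which has n + 1 elements.             *)
Definition linord (n : nat) : structure :=
  @Structure 'I_n.+1 ord0 ord_max
    (fun i j => (i < j)%N) (fun i j => i.+1 == j :> nat).

Definition term_val (A : structure) (s : nat) (rho : 'I_s -> A) (u : term s) :
    A :=
  match u with
  | Var v => rho v
  | Min => min_of A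
  | Max => max_of A
  end.

Fixpoint sat (A : structure) (s : nat) (rho : 'I_s -> A) (phi : formula s) :
    bool :=
  match phi with
  | Eq u w => term_val rho u == term_val rho w
  | Lt u w => lt_of (term_val rho u) (term_val rho w)
  | Succ u w => succ_of (term_val rho u) (term_val rho w)
  | Not psi => ~~ sat rho psi
  | Or psi chi => sat rho psi || sat rho chi
  | And psi chi => sat rho psi && sat rho chi
  | ExistsGe k _ v psi =>
      (k <= #|[set a : A | sat [eta rho with v |-> a] psi]|)%N
  | ForallGe k _ v psi =>
      ~~ (k <= #|[set a : A | ~~ sat [eta rho with v |-> a] psi]|)%N
  end.

(* For a sentence the truth value does not depend on the assignment.          *)
Definition models (A : structure) (s : nat) (phi : formula s) : Prop :=
  forall rho : 'I_s -> A, sat rho phi.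

(* Main.v *)
(* Distances between two points are only seen by a formula up to a threshold   *)
(* attached to the pair. For a formula of size s and counting rank at most t   *)
(* the following thresholds suffice: t s^2 for (min, max), t s (s + 1) / 2 for *)
(* a variable and an endpoint, and, for the three pairs of variables, values   *)
(* any two of which add up to at most t s. A quantifier of rank k on z raises  *)
(* the threshold of (u, w) to the sum of those of (u, z) and (z, w), plus k:   *)
(* then the points at a visible distance from u or w keep their room, and the  *)
(* number of the others between u and w is either unchanged or at least k on   *)
(* both sides. Since afterwards a single pair of variables has a nonzero       *)
(* threshold, the bound on two pairs grows only by k. Thus n > t s^2 would     *)
(* make A_n and A_m indistinguishable.                                         *)
Require Import Defs.
From mathcomp Require Import all_boot all_order all_algebra.
From mathcomp Require Import zify.

Set Implicit Arguments.
Unset Strict Implicit.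
Unset Printing Implicit Defensive.

Import Order.TTheory GRing.Theory Num.Theory.

(* a, b are ordered as a', b', at distances that are equal or both exceed d.   *)
Definition agree (d a b a' b' : nat) : Prop :=
  a + b' = a' + b \/ (a + d < b /\ a' + d < b') \/ (b + d < a /\ b' + d < a').

Lemma agree_le d e a b a' b' :
  d <= e -> agree e a b a' b' -> agree d a b a' b'.
Proof. rewrite /agree; lia. Qed.

Lemma agree_flip d a b a' b' : agree d a b a' b' -> agree d b a b' a'.
Proof. rewrite /agree; lia. Qed.

Lemma agree_sym d a b a' b' : agree d a b a' b' -> agree d a' b' a b.
Proof. rewrite /agree; lia. Qed.

(** * Counting up to a threshold in two orders of different lengths *)

Lemma leq_card_inj k m (A : {set 'I_m}) (f : 'I_k -> 'I_m) :
  injective f -> (forall i, f i \in A) -> k <= #|A|.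
Proof.
move=> f_inj fA; rewrite -[k]card_ord -(card_imset _ f_inj).
by apply/subset_leq_card/subsetP => _ /imsetP[i _ ->].
Qed.

(** If some point of [P] lies outside every window, its gap leaves room for [k] points of [Q].
    Otherwise each point of [P] moves along with a landmark [u] whose window contains it, which
    injects [P] into [Q]. *)
Lemma leq_card_transfer (T : finType) (lo hi : T) (r : T -> nat) (k n m : nat)
    (p q : T -> nat) (P : {set 'I_n.+1}) (Q : {set 'I_m.+1}) :
    p lo = 0 -> q lo = 0 -> p hi = n -> q hi = m ->
    (forall u w, agree (r u + r w + k) (p u) (p w) (q u) (q w)) ->
    (forall (a : 'I_n.+1) (b : 'I_m.+1),
       (forall u, agree (r u) (p u) a (q u) b) -> (a \in P) = (b \in Q)) ->
  k <= #|P| -> k <= #|Q|.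
Proof.
move=> plo qlo phi qhi pq PQ kP.
(* The window of u extends further to the right than to the left: were it     *)
(* symmetric, two windows whose points are not at the same distance on both   *)
(* sides could overlap.                                                       *)
pose near (a : 'I_n.+1) u := (p u <= a + r u) && (a <= p u + r u + k).
have [/existsP[a /andP[aP /forallP afar]]|] :=
  boolP [exists a in P, forall u, ~~ near a u].
  have far u : a + r u < p u \/ p u + r u + k < a.
    by have := afar u; rewrite /near; lia.
  have loa : p lo < a by have := far lo; lia.
  (* Among the landmarks left of [a], [w] blocks the furthest to the right in the second order.
     Agreement at [r w + r u + k] puts every landmark [u] right of [a] beyond the [k] positions that
     follow. *)
  case: (@arg_maxnP _ lo (fun u => p u < a) (fun u => q u + r u) loa)
    => w wa wmax.
  have fE (i : 'I_k) u : agree (r u) (p u) a (q u) (q w + r w + i.+1).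
    have := far u; have := far w; have := pq u w; have := ltn_ord i.
    have := wmax u; rewrite /agree; lia.
  have fm (i : 'I_k) : q w + r w + i.+1 < m.+1.
    by have := fE i hi; have := ltn_ord a; have := far hi; rewrite /agree; lia.
  apply: (@leq_card_inj _ _ _ (fun i => Ordinal (fm i))).
    by move=> i j /(congr1 val) /= ij; apply: val_inj => /=; lia.
  by move=> i; rewrite -(PQ a) //; apply: fE.
move=> /existsPn Pnear.
pose wit a := odflt lo [pick u | near a u].
have witP a : a \in P -> near a (wit a).
  move=> aP; rewrite /wit; case: pickP => //= nonear.
  have := Pnear a; rewrite aP /= => /forallPn[u].
  by rewrite nonear.
(* For [a] in [P], agreement with [lo] and [hi] rules out both truncated subtraction and the default
   of [inord]. *)
pose f (a : 'I_n.+1) : 'I_m.+1 := inord (q (wit a) + a - p (wit a)).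
have fval a : a \in P -> f a + p (wit a) = q (wit a) + a.
  move=> aP; have := witP a aP; have := pq (wit a) lo; have := pq (wit a) hi.
  have := ltn_ord a; rewrite /near /agree => an h1 h2 h3.
  rewrite /f inordK; lia.
have fQ a : a \in P -> f a \in Q.
  move=> aP; rewrite -(PQ a) // => u; have := fval a aP; have := witP a aP.
  have := pq (wit a) u; rewrite /near /agree; lia.
(* Either both points undergo the same translation, or their windows are disjoint in both orders and
   appear in the same sequence. *)
have finj : {in P &, injective f}.
  move=> a b aP bP fab; apply: val_inj => /=.
  have := fval a aP; have := fval b bP; rewrite fab.
  have := witP a aP; have := witP b bP; have := pq (wit a) (wit b).
  rewrite /near /agree; lia.
apply: leq_trans kP _; rewrite -(card_in_imset finj).
by apply/subset_leq_card/subsetP => _ /imsetP[a aP ->]; apply: fQ.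
Qed.

Lemma leq_card_agree (T : finType) (lo hi : T) (r : T -> nat) (k n m : nat)
    (p q : T -> nat) (P : {set 'I_n.+1}) (Q : {set 'I_m.+1}) :
    p lo = 0 -> q lo = 0 -> p hi = n -> q hi = m ->
    (forall u w, agree (r u + r w + k) (p u) (p w) (q u) (q w)) ->
    (forall (a : 'I_n.+1) (b : 'I_m.+1),
       (forall u, agree (r u) (p u) a (q u) b) -> (a \in P) = (b \in Q)) ->
  (k <= #|P|) = (k <= #|Q|).
Proof.
move=> plo qlo phi qhi pq PQ; apply/idP/idP.
  exact: (@leq_card_transfer T lo hi r k n m p q).
apply: (@leq_card_transfer T lo hi r k m n q p) => //.
  by move=> u w; apply: agree_sym.
by move=> a b ab; rewrite (PQ b a) // => u; apply: agree_sym.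
Qed.

(** * Thresholds on pairs of terms and the effect of one quantifier *)

Section Separators.

Variable s : nat.

Definition sep (D E : nat) (d : 'I_s -> 'I_s -> nat) (u w : term s) : nat :=
  match u, w with
  | Var x, Var y => d x y
  | Min, Max | Max, Min => D
  | Var _, _ | _, Var _ => E
  | _, _ => 0
  end.

Definition sim (D E : nat) (d : 'I_s -> 'I_s -> nat) (n m : nat)
    (rho : 'I_s -> linord n) (rho' : 'I_s -> linord m) : Prop :=
  forall u w : term s,
    agree (sep D E d u w)
      (term_val rho u : 'I_n.+1) (term_val rho w : 'I_n.+1)
      (term_val rho' u : 'I_m.+1) (term_val rho' w : 'I_m.+1).

Lemma sep_le D E d D' E' d' u w :
    D <= D' -> E <= E' -> (forall x y, d x y <= d' x y) ->
  sep D E d u w <= sep D' E' d' u w.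
Proof. by move=> lD lE ld; case: u w => [x||] [y||] /=. Qed.

Lemma sim_le D E d D' E' d' n m (rho : 'I_s -> linord n)
    (rho' : 'I_s -> linord m) :
    D <= D' -> E <= E' -> (forall x y, d x y <= d' x y) ->
  sim D' E' d' rho rho' -> sim D E d rho rho'.
Proof. by move=> lD lE ld H u w; apply: agree_le (H u w); apply: sep_le. Qed.

(** Pairs containing [v] get 0 because the quantifier rebinds [v]. *)
Definition qsep (k : nat) (v : 'I_s) (d : 'I_s -> 'I_s -> nat) x y :=
  if (x == v) || (y == v) then 0 else maxn (d x y) (d x v + d v y + k).

(** The landmarks when [v] is quantified, encoded as a finite type so that they can be searched and
    maximized over. *)
Definition point (v : 'I_s) (u : option (option {x | x != v})) : term s :=
  match u with
  | None => Min
  | Some None => Max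
  | Some (Some x) => Var (val x)
  end.

(** Here [leq_card_agree] is applied with the threshold to [v] as radius of each landmark. Pairs
    avoiding [v] keep their positions, so only pairs with [v] have to be checked for the updated
    assignments. *)
Lemma count_sim D E C d k v n m (rho : 'I_s -> linord n)
    (rho' : 'I_s -> linord m) (P : {set 'I_n.+1}) (Q : {set 'I_m.+1}) :
    commutative d -> (forall x y, x != y -> d x y <= C) ->
    (forall (a : 'I_n.+1) (b : 'I_m.+1),
      @sim D E d n m [eta rho with v |-> a] [eta rho' with v |-> b] ->
      (a \in P) = (b \in Q)) ->
    sim (maxn D (E + E + k)) (E + C + k) (qsep k v d) rho rho' ->
  (k <= #|P|) = (k <= #|Q|).
Proof.
move=> dsym dC PQ H.
pose p u : nat := term_val rho (@point v u) : 'I_n.+1.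
pose q u : nat := term_val rho' (@point v u) : 'I_m.+1.
pose r u := sep D E d (Var v) (@point v u).
apply: (@leq_card_agree _ None (Some None) r k n m p q) => //.
  move=> u w; have [->|uw] := eqVneq u w; first by left; rewrite addnC.
  apply: agree_le (H (point u) (point w)).
  case: u w uw => [[[x xv]|]|] [[[y yv]|]|] //= uw;
    rewrite /r /= /qsep ?(negPf xv) ?(negPf yv) /= ?(dsym v);
    try (have := dC x v xv); try (have := dC y v yv); lia.
move=> a b ab; apply: PQ.
have near_v (w : term s) : w <> Var v ->
    agree (sep D E d (Var v) w) (term_val rho w : 'I_n.+1) a
      (term_val rho' w : 'I_m.+1) b.
  case: w => [x||] xv; [|exact: (ab None)|exact: (ab (Some None))].
  have xv' : x != v by apply/eqP => e; apply: xv; rewrite e.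
  exact: (ab (Some (Some (exist _ x xv')))).
have upd (w : term s) : w <> Var v ->
    (forall l (sg : 'I_s -> linord l) c,
      term_val [eta sg with v |-> c] w = term_val sg w).
  case: w => //= x xv l sg c; case: eqP => // e; by case: xv; rewrite e.
have vP (w : term s) : w = Var v \/ w <> Var v.
  case: w => [x||]; [|by right|by right].
  by have [->|/eqP xv] := eqVneq x v; [left|right=> -[]].
have sepC u w : sep D E d u w = sep D E d w u.
  by case: u w => [x||] [y||] //=; rewrite dsym.
move=> u w; have [->|uv] := vP u; have [->|wv] := vP w.
- by left; rewrite addnC.
- rewrite !(upd w) //= eqxx; apply: agree_flip; exact: near_v.
- rewrite !(upd u) //= eqxx sepC; exact: near_v.
rewrite !(upd u) // !(upd w) //; apply: agree_le (H u w).
case: u w uv wv => [x||] [y||] //= uv wv; try lia; rewrite /qsep.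
- have -> : x == v = false by apply/eqP => e; apply: uv; rewrite e.
  have -> : y == v = false by apply/eqP => e; apply: wv; rewrite e.
  exact: leq_maxl.
Qed.

End Separators.

(** * Three variables: thresholds linear in the size on pairs of variables *)

Definition small_sep (C : nat) (d : 'I_3 -> 'I_3 -> nat) : Prop :=
  [/\ commutative d, forall x y, x != y -> d x y <= C &
      forall x y z, x != y -> y != z -> x != z -> d x y + d y z <= C].

Definition seps (t s : nat) (d : 'I_3 -> 'I_3 -> nat) n m :=
  @sim 3 (t * s ^ 2) (t * 'C(s.+1, 2)) d n m.

(** This is where having only three variables matters: of two distinct pairs, at least one contains
    the quantified variable. *)
Lemma ord3_cover (x y z v : 'I_3) :
  x != y -> y != z -> x != z -> [|| x == v, y == v | z == v].
Proof.
rewrite -!val_eqE /=.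
move: (ltn_ord x) (ltn_ord y) (ltn_ord z) (ltn_ord v); lia.
Qed.

Lemma small_sep_max C1 C2 d1 d2 :
  small_sep C1 d1 -> small_sep C2 d2 ->
  small_sep (C1 + C2) (fun x y => maxn (d1 x y) (d2 x y)).
Proof.
move=> [s1 le1 sum1] [s2 le2 sum2]; split.
- by move=> x y; rewrite s1 s2.
- by move=> x y xy; have := le1 x y xy; have := le2 x y xy; lia.
move=> x y z xy yz xz.
have := le1 x y xy; have := le2 x y xy; have := le1 y z yz; have := le2 y z yz.
by have := sum1 x y z xy yz xz; have := sum2 x y z xy yz xz; lia.
Qed.

Lemma small_sep_qsep C t k v d :
  k <= t -> small_sep C d -> small_sep (C + t) (qsep k v d).
Proof.
move=> kt [dsym dC dsum].
have qC x y : x != y -> qsep k v d x y <= C + t.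
  move=> xy; rewrite /qsep; case: ifPn => // /norP[xv yv].
  have vy : v != y by rewrite eq_sym.
  by have := dC x y xy; have := dsum x v y xv vy xy; lia.
split=> //.
- move=> x y; rewrite /qsep orbC; case: ifP => // _.
  by rewrite dsym (dsym x v) (dsym v y) (addnC (d v x)).
move=> x y z xy yz xz; case/or3P: (ord3_cover v xy yz xz) => vE.
- by rewrite {1}/qsep vE /=; apply: qC.
- by rewrite /qsep vE orbT.
- by rewrite [X in _ + X]/qsep vE orbT addn0; apply: qC.
Qed.

Lemma small_sep0 C : small_sep C (fun _ _ => 0).
Proof. by split. Qed.

Definition pair_sep (x y u w : 'I_3) : nat :=
  ((u == x) && (w == y)) || ((u == y) && (w == x)).

Lemma small_pair_sep C x y : 0 < C -> small_sep C (pair_sep x y).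
Proof.
move=> C0; rewrite /pair_sep; split.
- by move=> u w; rewrite orbC andbC [X in _ || X]andbC.
- by move=> u w _; apply: leq_trans (leq_b1 _) C0.
- move=> u w z; rewrite -!val_eqE /=; lia.
Qed.

Lemma seps_le t s s' d d' n m rho rho' :
    s <= s' -> (forall x y, d x y <= d' x y) ->
  @seps t s' d' n m rho rho' -> @seps t s d n m rho rho'.
Proof.
move=> ss' dd'; apply: sim_le => //.
  by rewrite leq_mul2l leq_sqr ss' orbT.
by rewrite leq_mul2l leq_bin2l ?orbT.
Qed.

Lemma fsize_gt0 s (phi : formula s) : 0 < fsize phi.
Proof. elim: phi => //= *; lia. Qed.

(** With [k <= t], the requirements are t s (s + 1) + k <= t (s + 1)^2 for the endpoints and C(s +
    1, 2) + s + 1 = C(s + 2, 2), times t, for a variable and an endpoint. *)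
Lemma seps_qsep t s k v d n m rho rho' :
    k <= t ->
    @seps t (s + 1) (qsep k v d) n m rho rho' ->
  sim (maxn (t * s ^ 2) (t * 'C(s.+1, 2) + t * 'C(s.+1, 2) + k))
    (t * 'C(s.+1, 2) + t * s + k) (qsep k v d) rho rho'.
Proof.
move=> kt; apply: sim_le => //; rewrite addn1.
  have := mul_bin_diag s.+1 1; rewrite /= bin1; nia.
rewrite (binS s.+1 1) bin1; nia.
Qed.

(** Which pairs of variables need a large threshold depends on the formula, hence the existential
    [d]; it is uniform in [n] and [m]. *)
Lemma formula_seps t (phi : formula 3) :
    0 < t -> counting_rank phi <= t ->
  exists2 d, small_sep (t * fsize phi) d &
    forall n m rho rho', @seps t (fsize phi) d n m rho rho' ->
      sat rho phi = sat rho' phi.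
Proof.
move=> t0.
elim: phi => [u w|u w|u w|f IH|f IHf g IHg|f IHf g IHg
              |k _ v f IH|k _ v f IH] /=.
- move=> _; exists (fun _ _ => 0); first exact: small_sep0.
  move=> n m rho rho' /(_ u w); rewrite /agree -!val_eqE /=; lia.
- move=> _; exists (fun _ _ => 0); first exact: small_sep0.
  move=> n m rho rho' /(_ u w); rewrite /agree /=; lia.
- move=> _.
  (* Successor must see distance 1. With an endpoint involved, the thresholds at size 1 are already
     [t >= 1]. *)
  exists (if (u, w) is (Var x, Var y) then pair_sep x y else fun _ _ => 0).
    case: u w => [x||] [y||]; try exact: small_sep0.
    by apply: small_pair_sep; rewrite muln1.
  move=> n m rho rho' /(_ u w).
  case: u w => [x||] [y||];
    rewrite /agree /pair_sep /= ?eqxx ?binn ?exp1n ?muln1 /=; lia.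
- move=> /IH[d dsmall dP]; exists d.
    case: dsmall => dsym dC dsum; split=> // [x y xy|x y z xy yz xz].
      by apply: leq_trans (dC x y xy) _; rewrite leq_mul2l leq_addr orbT.
    apply: leq_trans (dsum x y z xy yz xz) _.
    by rewrite leq_mul2l leq_addr orbT.
  move=> n m rho rho' H; congr (~~ _); apply: dP.
  by apply: seps_le H => //; apply: leq_addr.
- rewrite geq_max => /andP[/IHf[d1 small1 dP1] /IHg[d2 small2 dP2]].
  exists (fun x y => maxn (d1 x y) (d2 x y)).
    by rewrite mulnDr; apply: small_sep_max.
  move=> n m rho rho' H; congr (_ || _); [apply: dP1|apply: dP2];
    by apply: seps_le H => *; rewrite ?leq_addr ?leq_addl ?leq_maxl ?leq_maxr.
- rewrite geq_max => /andP[/IHf[d1 small1 dP1] /IHg[d2 small2 dP2]].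
  exists (fun x y => maxn (d1 x y) (d2 x y)).
    by rewrite mulnDr; apply: small_sep_max.
  move=> n m rho rho' H; congr (_ && _); [apply: dP1|apply: dP2];
    by apply: seps_le H => *; rewrite ?leq_addr ?leq_addl ?leq_maxl ?leq_maxr.
- rewrite geq_max => /andP[kt /IH[d dsmall dP]]; exists (qsep k v d).
    by rewrite mulnDr muln1; apply: small_sep_qsep.
  case: dsmall => dsym dC _ n m rho rho' /(seps_qsep kt).
  apply: count_sim => // a b ab; rewrite !inE; exact: dP.
- rewrite geq_max => /andP[kt /IH[d dsmall dP]]; exists (qsep k v d).
    by rewrite mulnDr muln1; apply: small_sep_qsep.
  case: dsmall => dsym dC _ n m rho rho' /(seps_qsep kt) H; congr (~~ _).
  apply: count_sim H => // a b ab; rewrite !inE; congr (~~ _); exact: dP.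
Qed.

Theorem theorem5 (R : rcfType) (t n m : nat) (phi : formula 3)
    (t_ge1 : (1 <= t)%N) (lt_nm : (n < m)%N)
    (phi_sentence : sentence phi) (phi_rank : (counting_rank phi <= t)%N)
    (An_phi : models (linord n) phi) (Am_not_phi : models (linord m) (Not phi)) :
  (Num.sqrt (n%:R : R) / t%:R <= (fsize phi)%:R)%R.
Proof.
have [d _ dP] := formula_seps t_ge1 phi_rank.
have n_le : n <= t * fsize phi ^ 2.
  rewrite leqNgt; apply/negP => lt_n.
  have /negP := Am_not_phi (fun=> ord0); apply.
  have := An_phi (fun=> ord0); rewrite (dP n m _ (fun=> ord0)) // => u w.
  have s0 := fsize_gt0 phi.
  have lt_E : t * 'C((fsize phi).+1, 2) < n.
    apply: leq_ltn_trans lt_n; rewrite leq_mul2l; apply/orP; right.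
    have := mul_bin_diag (fsize phi).+1 1; rewrite /= bin1; nia.
  (* With all variables at 0, only the distances to [Max] differ between the two orders, and these
     exceed the thresholds. *)
  by case: u w => [x||] [y||]; rewrite /agree /=; lia.
have t_gt0 : (0 < t%:R :> R)%R by rewrite ltr0n.
rewrite ler_pdivrMr // -natrM -(ger0_norm (ler0n R (_ * t))) -sqrtr_sqr.
apply: ler_wsqrtr; rewrite -natrX ler_nat; apply: leq_trans n_le _.
(* Since [t >= 1], t s^2 <= (s t)^2. *)
nia.
Qed.
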